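(* Let $(I,G,\pi)$, with $I:\mathbf{A}\to\mathbf{B}$, $G:\mathbf{B}\to\mathbf{A}$, $\pi:1_{\mathbf{A}}\to GI$, be a half-reflection. If the functor $G$ admits a left adjoint, with adjunction $(F,G,\eta,\varepsilon)$, and $F$ is faithful and injective on objects, then there are isomorphisms of categories $$\mathbf{A}_1\cong RG_{\mathbf{A}}(\mathbf{B}),\qquad \mathbf{A}_2^{*}\cong PC_{\mathbf{A}}(\mathbf{B}),$$ where $\mathbf{A}_2^{*}$ is the subcategory of $\mathbf{A}_2$ given by the objects $((E,v),a,b,(A,u))$ such that $$IE=FA,\qquad I(a)=\varepsilon_{IA}F(u),\qquad vb=\eta_A,\qquad G\big(\varepsilon_{IA}F(\pi_A)\big)\pi_E=G\big(\varepsilon_{IA}F(\pi_A)\big)v.$$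
   Context: A pair of functors $I:\mathbf{A}\to\mathbf{B}$, $G:\mathbf{B}\to\mathbf{A}$ with $IG=1_{\mathbf{B}}$ (strict equality) is a half-reflection, with natural transformation $\pi:1_{\mathbf{A}}\to GI$, if $I(\pi_A)=1_{IA}$ for all $A$. Here $\eta:1_{\mathbf{A}}\to GF$ is the unit and $\varepsilon:FG\to 1_{\mathbf{B}}$ the counit. Write $\pi'_A=\varepsilon_{IA}F(\pi_A):FA\to IA$; it is a split epimorphism with section $I(\eta_A):IA\to IGFA=FA$, and $A\mapsto(FA,\pi'_A,I(\eta_A),IA)$, $f\mapsto(F(f),I(f))$, is a functor $T$ from $\mathbf{A}$ to the category $Pt(\mathbf{B})$ of split epimorphisms in $\mathbf{B}$, through which $\mathbf{A}$ is viewed as a (not necessarily full) subcategory of $Pt(\mathbf{B})$. $\mathbf{A}_1$: objects are pairs $(A,u)$ with $A\in\mathbf{A}$ and $u:A\to GIA$ such that $I(u)=1$; a morphism $f:(A,u)\to(A',u')$ is a morphism $f:A\to A'$ in $\mathbf{A}$ with $u'f=GI(f)u$. $\mathbf{A}_2$: objects are systems $((E,v),a,b,(A,u))$ where $(E,v),(A,u)$ are objects of $\mathbf{A}_1$, $a:(E,v)\to(A,u)$ is a morphism in $\mathbf{A}_1$, and $b:A\to E$ is a morphism in $\mathbf{A}$ with $ab=1_A$; morphisms are pairs of morphisms $(E,v)\to(E',v')$, $(A,u)\to(A',u')$ of $\mathbf{A}_1$ compatible with the $a$'s and $b$'s. $\mathbf{A}_2^{*}$ is the full subcategory on the indicated objects.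 $RG_{\mathbf{A}}(\mathbf{B})$ (reflexive graphs in $\mathbf{B}$ relative to the split epimorphisms in $T(\mathbf{A})$): objects are reflexive graphs consisting of $\pi'_A,c:FA\to IA$ and $I(\eta_A):IA\to FA$, for some $A\in\mathbf{A}$, with $cI(\eta_A)=1_{IA}$; morphisms are the morphisms of reflexive graphs of the form $(F(f),I(f))$ with $f:A\to A'$ in $\mathbf{A}$. $PC_{\mathbf{A}}(\mathbf{B})$ (internal precategories in $\mathbf{B}$ relative to the split epimorphisms in $T(\mathbf{A})$): objects are diagrams consisting of $\pi'_E,\,m,\,F(a):F(E)\to IE=FA$, with $I(\eta_E),F(b):FA=IE\to F(E)$, and $\pi'_A,c:FA\to IA$ with $I(\eta_A):IA\to FA$, for some $a:E\to A$, $b:A\to E$ in $\mathbf{A}$ with $ab=1_A$ and $IE=FA$, satisfying $$cI(\eta_A)=1_{IA},\quad I(a)=c,\quad I(b)=I(\eta_A),\quad mI(\eta_E)=1_{IE},\quad mF(b)=1_{IE},\quad cm=cF(a),\quad \pi'_Am=\pi'_A\pi'_E;$$ morphisms are given by pairs $g:E\to E'$, $f:A\to A'$ in $\mathbf{A}$ with $I(g)=F(f)$, $a'g=fa$, $b'f=gb$ such that the triple $(F(g),F(f),I(f))$ commutes with all the structure of the diagrams. *)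

(* Defs.v *)
From Corelib Require Import ssreflect ssrfun ssrbool.
From Stdlib Require Import ProofIrrelevance.

Set Implicit Arguments.
Unset Strict Implicit.
Unset Printing Implicit Defensive.

Declare Scope cat_scope.
Delimit Scope cat_scope with cat.
Local Open Scope cat_scope.

(** Equality of objects, of morphisms with given source and target, and of
    functors is Leibniz equality. *)

Record category := Category {
  ob :> Type;
  hom : ob -> ob -> Type;
  idm : forall x, hom x x;
  comp : forall x y z, hom y z -> hom x y -> hom x z;
  comp1m : forall x y (f : hom x y), comp (idm y) f = f;
  compm1 : forall x y (f : hom x y), comp f (idm x) = f;
  compA : forall x y z t (h : hom z t) (g : hom y z) (f : hom x y),
    comp h (comp g f) = comp (comp h g) f }.

Arguments hom {c} x y.
Arguments idm {c} x.
Arguments comp {c x y z} g f.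

Notation "g ∘ f" := (comp g f) (at level 40, left associativity) : cat_scope.

(** The identity morphism of [x], read as a morphism [x -> y] along [x = y].
    Composing with it is how an identity such as [IE = FA], used silently in
    informal notation to make composites well formed, is written down. *)
Definition eqhom (C : category) (x y : C) (e : x = y) : hom x y :=
  match e in _ = z return hom x z with eq_refl => idm x end.

Record functor (C D : category) := Functor {
  fob :> C -> D;
  fmap : forall x y : C, hom x y -> hom (fob x) (fob y);
  fmap1 : forall x, fmap (idm x) = idm (fob x);
  fmapM : forall x y z (g : hom y z) (f : hom x y),
    fmap (g ∘ f) = fmap g ∘ fmap f }.

Arguments fmap {C D} _ {x y} _.

Definition fid (C : category) : functor C C :=
  @Functor C C (fun x => x) (fun _ _ f => f)
    (fun _ => eq_refl) (fun _ _ _ _ _ => eq_refl).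

Section Fcomp.
Context (C D E : category) (S : functor D E) (T : functor C D).

Lemma fcomp1 x : fmap S (fmap T (idm x)) = idm (S (T x)).
Proof. by rewrite !fmap1. Qed.

Lemma fcompM x y z (g : hom y z) (f : hom x y) :
  fmap S (fmap T (g ∘ f)) = fmap S (fmap T g) ∘ fmap S (fmap T f).
Proof. by rewrite !fmapM. Qed.

Definition fcomp : functor C E :=
  @Functor C E (fun x => S (T x)) (fun _ _ f => fmap S (fmap T f))
    fcomp1 fcompM.
End Fcomp.

Record nattrans (C D : category) (S T : functor C D) := NatTrans {
  ncomp :> forall x : C, hom (S x) (T x);
  ncomp_nat : forall x y (f : hom x y),
    ncomp y ∘ fmap S f = fmap T f ∘ ncomp x }.

Record adjunction (C D : category) (F : functor C D) (G : functor D C) :=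
  Adjunction {
    unit : nattrans (fid C) (fcomp G F);
    counit : nattrans (fcomp F G) (fid D);
    triangle_l : forall x, counit (F x) ∘ fmap F (unit x) = idm (F x);
    triangle_r : forall y, fmap G (counit y) ∘ unit (G y) = idm (G y) }.

Definition faithful (C D : category) (F : functor C D) : Prop :=
  forall (x y : C) (f g : hom x y), fmap F f = fmap F g -> f = g.

Definition injective_on_objects (C D : category) (F : functor C D) : Prop :=
  injective (fob F).

Definition isomorphic_categories (C D : category) : Prop :=
  exists (S : functor C D) (T : functor D C),
    fcomp T S = fid C /\ fcomp S T = fid D.

Section Eqhom.
Context (C D : category).

Lemma fmap_eqhom (S : functor C D) (x y : C) (e : x = y) :
  fmap S (eqhom e) = eqhom (f_equal (fob S) e).
Proof. by case: _ / e; rewrite fmap1. Qed.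

Definition functor_eq_ob (S T : functor C D) (e : S = T) (x : C) : S x = T x :=
  f_equal (fun K : functor C D => K x) e.

Lemma functor_eq_hom (S T : functor C D) (e : S = T) (x y : C) (f : hom x y) :
  eqhom (functor_eq_ob e y) ∘ fmap S f = fmap T f ∘ eqhom (functor_eq_ob e x).
Proof. by case: _ / e => /=; rewrite comp1m compm1. Qed.
End Eqhom.

Lemma sig_eq (T : Type) (P : T -> Prop) (u v : {x : T | P x}) :
  proj1_sig u = proj1_sig v -> u = v.
Proof.
case: u v => [x px] [y py] /= e; subst y.
by rewrite (proof_irrelevance _ px py).
Qed.

Section FullSubcategory.
Context (C : category) (P : C -> Prop).

Definition full_subcategory : category :=
  @Category {x : C | P x} (fun x y => hom (proj1_sig x) (proj1_sig y))
    (fun x => idm (proj1_sig x)) (fun _ _ _ g f => g ∘ f)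
    (fun _ _ => @comp1m C _ _) (fun _ _ => @compm1 C _ _)
    (fun _ _ _ _ => @compA C _ _ _ _).
End FullSubcategory.

(** The (not necessarily full) subcategory of [C] whose objects are those of
    the form [j d] and whose morphisms are the [phi : j d -> j d'] such that
    [R d d' phi].  Injectivity of [j] is what makes it closed under
    composition. *)
Section ImageSubcategory.
Context (C : category) (X : Type) (j : X -> C).
Context (R : forall d d' : X, hom (j d) (j d') -> Prop).
Context (j_inj : injective j).
Context (R1 : forall d, R (idm (j d))).
Context (RM : forall d d' d'' (psi : hom (j d') (j d'')) (phi : hom (j d) (j d')),
  R psi -> R phi -> R (psi ∘ phi)).

Definition image_ob (x : C) : Prop := exists d, j d = x.

Inductive image_hom : forall x y : C, hom x y -> Prop :=
  ImageHom d d' (phi : hom (j d) (j d')) : R phi -> image_hom phi.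

Lemma image_hom_inv x y (phi : hom x y) d' (e : y = j d') :
  image_hom phi ->
  exists d (phi' : hom (j d) (j d')) (e' : j d = x),
    R phi' /\ phi' = eqhom e ∘ phi ∘ eqhom e'.
Proof.
move=> H; case: H e => d d0 psi Rpsi e.
have E := j_inj e; subst d0.
rewrite (proof_irrelevance _ e eq_refl) /=.
by exists d, psi, eq_refl; rewrite /= comp1m compm1.
Qed.

Lemma image_hom1 x : image_ob x -> image_hom (idm x).
Proof. by case=> d <-; apply: ImageHom. Qed.

Lemma image_homM x y z (psi : hom y z) (phi : hom x y) :
  image_hom psi -> image_hom phi -> image_hom (psi ∘ phi).
Proof.
move=> H; case: H phi => d' d'' {}psi Rpsi phi /(@image_hom_inv _ _ _ d' eq_refl).
case=> d [phi' [e [Rphi Ephi]]]; case: _ / e phi Ephi => phi /=.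
by rewrite comp1m compm1 => <-; apply/ImageHom/RM.
Qed.

Definition image_subcategory : category.
Proof.
refine (@Category {x : C | image_ob x}
  (fun x y => {phi : hom (proj1_sig x) (proj1_sig y) | image_hom phi})
  (fun x => exist _ (idm (proj1_sig x)) (image_hom1 (proj2_sig x)))
  (fun _ _ _ g f => exist _ (proj1_sig g ∘ proj1_sig f)
     (image_homM (proj2_sig g) (proj2_sig f))) _ _ _).
- by move=> x y f; apply: sig_eq; apply: comp1m.
- by move=> x y f; apply: sig_eq; apply: compm1.
- by move=> x y z t h g f; apply: sig_eq; apply: compA.
Defined.
End ImageSubcategory.

Section Graphs.
Context (B : category).

Record rgraph := RGraph {
  edges : B;
  verts : B;
  rdom : hom edges verts;
  rcod : hom edges verts;
  rloop : hom verts edges;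
  rdomK : rdom ∘ rloop = idm verts;
  rcodK : rcod ∘ rloop = idm verts }.

Definition rgraph_hom_axiom (X Y : rgraph)
    (f : hom (edges X) (edges Y) * hom (verts X) (verts Y)) : Prop :=
  [/\ rdom Y ∘ f.1 = f.2 ∘ rdom X,
      rcod Y ∘ f.1 = f.2 ∘ rcod X &
      f.1 ∘ rloop X = rloop Y ∘ f.2].

Definition rgraph_hom (X Y : rgraph) := {f | @rgraph_hom_axiom X Y f}.

Definition edge_map X Y (f : rgraph_hom X Y) := (proj1_sig f).1.
Definition vert_map X Y (f : rgraph_hom X Y) := (proj1_sig f).2.

Lemma rgraph_hom1 X : rgraph_hom_axiom (idm (edges X), idm (verts X)).
Proof. by split; rewrite /= comp1m compm1. Qed.

Lemma rgraph_homM X Y Z (g : rgraph_hom Y Z) (f : rgraph_hom X Y) :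
  @rgraph_hom_axiom X Z (edge_map g ∘ edge_map f, vert_map g ∘ vert_map f).
Proof.
case: f g => [[f1 f0] [/= fd fc fe]] [[g1 g0] [/= gd gc ge]].
split; rewrite /edge_map /vert_map /=.
- by rewrite compA gd -compA fd compA.
- by rewrite compA gc -compA fc compA.
- by rewrite -compA fe compA ge compA.
Qed.

Definition rgraph_category : category.
Proof.
refine (@Category rgraph rgraph_hom
  (fun X => exist _ _ (rgraph_hom1 X))
  (fun X Y Z g f => exist _ _ (rgraph_homM g f)) _ _ _).
- move=> X Y f; apply: sig_eq; rewrite /= /edge_map /vert_map /= !comp1m.
  by case: (proj1_sig f).
- move=> X Y f; apply: sig_eq; rewrite /= /edge_map /vert_map /= !compm1.
  by case: (proj1_sig f).
- move=> X Y Z T h g f; apply: sig_eq.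
  by rewrite /= /edge_map /vert_map /= !compA.
Defined.

(** Diagrams [C2 ⇶ C1 ⇉ C0] with common sections, no identity being imposed:
    [pfst], [pmul], [psnd : C2 -> C1] and [pinl], [pinr : C1 -> C2], together
    with [pdom], [pcod : C1 -> C0] and [ploop : C0 -> C1]. *)
Record pdiag := PDiag {
  pC2 : B;
  pC1 : B;
  pC0 : B;
  pfst : hom pC2 pC1;
  pmul : hom pC2 pC1;
  psnd : hom pC2 pC1;
  pinl : hom pC1 pC2;
  pinr : hom pC1 pC2;
  pdom : hom pC1 pC0;
  pcod : hom pC1 pC0;
  ploop : hom pC0 pC1 }.

Record pdiag_hom_axiom (X Y : pdiag)
    (f : hom (pC2 X) (pC2 Y) * hom (pC1 X) (pC1 Y) * hom (pC0 X) (pC0 Y)) :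
    Prop := PDiagHomAxiom {
  phom_fst : pfst Y ∘ f.1.1 = f.1.2 ∘ pfst X;
  phom_mul : pmul Y ∘ f.1.1 = f.1.2 ∘ pmul X;
  phom_snd : psnd Y ∘ f.1.1 = f.1.2 ∘ psnd X;
  phom_inl : f.1.1 ∘ pinl X = pinl Y ∘ f.1.2;
  phom_inr : f.1.1 ∘ pinr X = pinr Y ∘ f.1.2;
  phom_dom : pdom Y ∘ f.1.2 = f.2 ∘ pdom X;
  phom_cod : pcod Y ∘ f.1.2 = f.2 ∘ pcod X;
  phom_loop : f.1.2 ∘ ploop X = ploop Y ∘ f.2 }.

Definition pdiag_hom (X Y : pdiag) := {f | @pdiag_hom_axiom X Y f}.

Definition map2 X Y (f : pdiag_hom X Y) := (proj1_sig f).1.1.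
Definition map1 X Y (f : pdiag_hom X Y) := (proj1_sig f).1.2.
Definition map0 X Y (f : pdiag_hom X Y) := (proj1_sig f).2.

Lemma pdiag_hom1 X :
  pdiag_hom_axiom (idm (pC2 X), idm (pC1 X), idm (pC0 X)).
Proof. by split; rewrite /= comp1m compm1. Qed.

Lemma pdiag_homM X Y Z (g : pdiag_hom Y Z) (f : pdiag_hom X Y) :
  @pdiag_hom_axiom X Z (map2 g ∘ map2 f, map1 g ∘ map1 f, map0 g ∘ map0 f).
Proof.
case: f g => [[[f2 f1] f0] [/= ff fm fs fl fr fd fc fe]].
case=> [[[g2 g1] g0] [/= gf gm gs gl gr gd gc ge]].
split; rewrite /map2 /map1 /map0 /=.
- by rewrite compA gf -compA ff compA.
- by rewrite compA gm -compA fm compA.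
- by rewrite compA gs -compA fs compA.
- by rewrite -compA fl compA gl compA.
- by rewrite -compA fr compA gr compA.
- by rewrite compA gd -compA fd compA.
- by rewrite compA gc -compA fc compA.
- by rewrite -compA fe compA ge compA.
Qed.

Definition pdiag_category : category.
Proof.
refine (@Category pdiag pdiag_hom
  (fun X => exist _ _ (pdiag_hom1 X))
  (fun X Y Z g f => exist _ _ (pdiag_homM g f)) _ _ _).
- move=> X Y f; apply: sig_eq; rewrite /= /map2 /map1 /map0 /= !comp1m.
  by case: (proj1_sig f) => [[]].
- move=> X Y f; apply: sig_eq; rewrite /= /map2 /map1 /map0 /= !compm1.
  by case: (proj1_sig f) => [[]].
- move=> X Y Z T h g f; apply: sig_eq.
  by rewrite /= /map2 /map1 /map0 /= !compA.
Defined.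
End Graphs.

Record half_reflection (A B : category) (I : functor A B) (G : functor B A)
    (pi : nattrans (fid A) (fcomp G I)) := HalfReflection {
  hr_eq : fcomp I G = fid B;
  hr_pi : forall X : A, eqhom (functor_eq_ob hr_eq (I X)) ∘ fmap I (pi X) = idm (I X) }.

Section HalfReflection.
Context (A B : category) (I : functor A B) (G : functor B A).
Context (pi : nattrans (fid A) (fcomp G I)) (hr : half_reflection pi).

Definition IG (Y : B) : I (G Y) = Y := functor_eq_ob (hr_eq hr) Y.

Lemma IG_nat Y Y' (f : hom Y Y') :
  eqhom (IG Y') ∘ fmap I (fmap G f) = f ∘ eqhom (IG Y).
Proof. exact: (functor_eq_hom (hr_eq hr) f). Qed.

(** [a1_uP] reads [I(u) = 1], along [IGIX = IX]. *)
Record A1_ob := A1Ob {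
  a1_ob :> A;
  a1_u : hom a1_ob (G (I a1_ob));
  a1_uP : eqhom (IG (I a1_ob)) ∘ fmap I a1_u = idm (I a1_ob) }.

Definition A1_hom (X Y : A1_ob) :=
  {f : hom (X : A) (Y : A) | a1_u Y ∘ f = fmap G (fmap I f) ∘ a1_u X}.

Lemma A1_hom1 (X : A1_ob) :
  a1_u X ∘ idm (X : A) = fmap G (fmap I (idm (X : A))) ∘ a1_u X.
Proof. by rewrite !fmap1 comp1m compm1. Qed.

Lemma A1_homM (X Y Z : A1_ob) (g : A1_hom Y Z) (f : A1_hom X Y) :
  a1_u Z ∘ (proj1_sig g ∘ proj1_sig f) =
  fmap G (fmap I (proj1_sig g ∘ proj1_sig f)) ∘ a1_u X.
Proof.
by rewrite compA (proj2_sig g) -compA (proj2_sig f) compA !fmapM.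
Qed.

Definition A1 : category.
Proof.
refine (@Category A1_ob A1_hom
  (fun X => exist _ _ (A1_hom1 X))
  (fun X Y Z g f => exist _ _ (A1_homM g f)) _ _ _).
- by move=> X Y f; apply: sig_eq; apply: comp1m.
- by move=> X Y f; apply: sig_eq; apply: compm1.
- by move=> X Y Z T h g f; apply: sig_eq; apply: compA.
Defined.

Record A2_ob := A2Ob {
  a2_E : A1;
  a2_A : A1;
  a2_a : hom a2_E a2_A;
  a2_b : hom (a1_ob a2_A) (a1_ob a2_E);
  a2_ab : proj1_sig a2_a ∘ a2_b = idm (a1_ob a2_A) }.

Definition A2_hom_axiom (X Y : A2_ob)
    (gf : hom (a2_E X) (a2_E Y) * hom (a2_A X) (a2_A Y)) : Prop :=
  a2_a Y ∘ gf.1 = gf.2 ∘ a2_a X /\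
  a2_b Y ∘ proj1_sig gf.2 = proj1_sig gf.1 ∘ a2_b X.

Definition A2_hom (X Y : A2_ob) := {gf | @A2_hom_axiom X Y gf}.

Lemma A2_hom1 (X : A2_ob) : @A2_hom_axiom X X (idm (a2_E X), idm (a2_A X)).
Proof.
split; rewrite /fst /snd; first by rewrite (@comp1m A1) (@compm1 A1).
by rewrite /= comp1m compm1.
Qed.

Lemma A2_homM (X Y Z : A2_ob) (q : A2_hom Y Z) (p : A2_hom X Y) :
  @A2_hom_axiom X Z ((proj1_sig q).1 ∘ (proj1_sig p).1,
                     (proj1_sig q).2 ∘ (proj1_sig p).2).
Proof.
case: p q => [[pg pf] [pa pb]] [[qg qf] [qa qb]].
cbn [fst snd] in pa, pb, qa, qb; split; cbn [proj1_sig fst snd].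
  by rewrite (@compA A1) qa -(@compA A1) pa (@compA A1).
by rewrite /= compA qb -compA pb compA.
Qed.

Definition A2 : category.
Proof.
refine (@Category A2_ob A2_hom
  (fun X => exist _ _ (A2_hom1 X))
  (fun X Y Z g f => exist _ _ (A2_homM g f)) _ _ _).
- move=> X Y [[g f] gf]; apply: sig_eq; cbn [proj1_sig fst snd].
  by rewrite !(@comp1m A1).
- move=> X Y [[g f] gf]; apply: sig_eq; cbn [proj1_sig fst snd].
  by rewrite !(@compm1 A1).
- move=> X Y Z T h g f; apply: sig_eq; cbn [proj1_sig fst snd].
  by rewrite !(@compA A1).
Defined.

Section Adjoint.
Context (F : functor A B) (adj : adjunction F G).
Notation eta := (unit adj).
Notation eps := (counit adj).

Definition pi' (X : A) : hom (F X) (I X) := eps (I X) ∘ fmap F (pi X).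

(** [I(eta_X) : IX -> IGFX = FX]. *)
Definition I_eta (X : A) : hom (I X) (F X) :=
  eqhom (IG (F X)) ∘ fmap I (eta X).

Lemma pi'K (X : A) : pi' X ∘ I_eta X = idm (I X).
Proof.
rewrite -(hr_pi hr X) /I_eta compA -IG_nat -compA -fmapM; congr (_ ∘ fmap I _).
rewrite /pi' fmapM -compA -(ncomp_nat eta (pi X)) compA.
by rewrite /= triangle_r comp1m.
Qed.

(** The identity [e : IE = FZ] enters the equations through [eqhom e] and, after
    applying [G], through [eqhom] along [GIE = GFZ]. *)
Definition A2_star_ob (X : A2) : Prop :=
  let E := a1_ob (a2_E X) in let v := a1_u (a2_E X) in
  let Z := a1_ob (a2_A X) in let u := a1_u (a2_A X) in
  let a := proj1_sig (a2_a X) in let b := a2_b X in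
  exists e : I E = F Z,
  [/\ fmap I a = (eps (I Z) ∘ fmap F u) ∘ eqhom e,
      eqhom (f_equal (fob G) e) ∘ (v ∘ b) = eta Z &
      fmap G (eps (I Z) ∘ fmap F (pi Z)) ∘ eqhom (f_equal (fob G) e) ∘ pi E =
      fmap G (eps (I Z) ∘ fmap F (pi Z)) ∘ eqhom (f_equal (fob G) e) ∘ v].

Definition A2_star : category := full_subcategory A2_star_ob.

(** An object of [RG] is a reflexive graph in [B], and a morphism is a morphism
    of reflexive graphs in [B]; [A] only occurs through the existence of the
    data below. *)
Record rg_data := RGData {
  rg_A : A;
  rg_c : hom (F rg_A) (I rg_A);
  rg_cP : rg_c ∘ I_eta rg_A = idm (I rg_A) }.

Definition rg_graph (d : rg_data) : rgraph_category B :=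
  RGraph (pi'K (rg_A d)) (rg_cP d).

Definition rg_hom (d d' : rg_data) (phi : hom (rg_graph d) (rg_graph d')) : Prop :=
  exists f : hom (rg_A d) (rg_A d'),
    edge_map phi = fmap F f /\ vert_map phi = fmap I f.

Lemma rg_graph_inj : injective_on_objects F -> injective rg_graph.
Proof.
move=> F_inj [X c cP] [X' c' cP'] e.
have EX : X = X' by apply: F_inj; apply: (f_equal (@edges B) e).
subst X'; move: e; rewrite /rg_graph /= => -[].
move=> /(inj_pair2 _ _ _ _ _)/(inj_pair2 _ _ _ _ _) Ec.
by subst c'; rewrite (proof_irrelevance _ cP cP').
Qed.

Lemma rg_hom1 d : rg_hom (idm (rg_graph d)).
Proof. by exists (idm _); rewrite !fmap1. Qed.

Lemma rg_homM d d' d'' (psi : hom (rg_graph d') (rg_graph d''))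
    (phi : hom (rg_graph d) (rg_graph d')) :
  rg_hom psi -> rg_hom phi -> rg_hom (psi ∘ phi).
Proof.
case=> [g [g1 g0]] [f [f1 f0]]; exists (g ∘ f).
by rewrite !fmapM -g1 -g0 -f1 -f0.
Qed.

Definition RG (F_inj : injective_on_objects F) : category :=
  image_subcategory (rg_graph_inj F_inj) rg_hom1 rg_homM.

(** Likewise an object of [PC] is a diagram in [B].  Its middle object is
    written [FA] rather than [IE].  A morphism is a triple [(Fg, Ff, If)]; since
    [F] is faithful this is the same as the pair [(g, f)]. *)
Record pc_data := PCData {
  pc_E : A;
  pc_A : A;
  pc_a : hom pc_E pc_A;
  pc_b : hom pc_A pc_E;
  pc_IE : I pc_E = F pc_A;
  pc_m : hom (F pc_E) (F pc_A);
  pc_c : hom (F pc_A) (I pc_A);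
  pc_ab : pc_a ∘ pc_b = idm pc_A;
  pc_ce : pc_c ∘ I_eta pc_A = idm (I pc_A);
  pc_Ia : fmap I pc_a = pc_c ∘ eqhom pc_IE;
  pc_Ib : eqhom pc_IE ∘ fmap I pc_b = I_eta pc_A;
  pc_ml : pc_m ∘ (I_eta pc_E ∘ eqhom (eq_sym pc_IE)) = idm (F pc_A);
  pc_mr : pc_m ∘ fmap F pc_b = idm (F pc_A);
  pc_cm : pc_c ∘ pc_m = pc_c ∘ fmap F pc_a;
  pc_dm : pi' pc_A ∘ pc_m = pi' pc_A ∘ (eqhom pc_IE ∘ pi' pc_E) }.

Definition pc_diagram (d : pc_data) : pdiag_category B :=
  {| pC2 := F (pc_E d);
     pC1 := F (pc_A d);
     pC0 := I (pc_A d);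
     pfst := eqhom (pc_IE d) ∘ pi' (pc_E d);
     pmul := pc_m d;
     psnd := fmap F (pc_a d);
     pinl := I_eta (pc_E d) ∘ eqhom (eq_sym (pc_IE d));
     pinr := fmap F (pc_b d);
     pdom := pi' (pc_A d);
     pcod := pc_c d;
     ploop := I_eta (pc_A d) |}.

Definition pc_hom (d d' : pc_data) (phi : hom (pc_diagram d) (pc_diagram d')) :
    Prop :=
  exists (g : hom (pc_E d) (pc_E d')) (f : hom (pc_A d) (pc_A d')),
    [/\ eqhom (pc_IE d') ∘ fmap I g = fmap F f ∘ eqhom (pc_IE d),
        pc_a d' ∘ g = f ∘ pc_a d,
        pc_b d' ∘ f = g ∘ pc_b d &
        [/\ map2 phi = fmap F g, map1 phi = fmap F f & map0 phi = fmap I f]].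

Lemma pc_diagram_inj :
  faithful F -> injective_on_objects F -> injective pc_diagram.
Proof.
move=> F_faith F_inj.
case=> [E X a b e m c h1 h2 h3 h4 h5 h6 h7 h8].
case=> [E' X' a' b' e' m' c' k1 k2 k3 k4 k5 k6 k7 k8] H.
have EE : E = E' by apply: F_inj; apply: (f_equal (@pC2 B) H).
have EX : X = X' by apply: F_inj; apply: (f_equal (@pC1 B) H).
subst E' X'; move: H; rewrite /pc_diagram /= => -[].
have Ee := proof_irrelevance _ e e'; subst e' => _.
move=> /(inj_pair2 _ _ _ _ _)/(inj_pair2 _ _ _ _ _) Em.
move=> /(inj_pair2 _ _ _ _ _)/(inj_pair2 _ _ _ _ _)/F_faith Ea _.
move=> /(inj_pair2 _ _ _ _ _)/(inj_pair2 _ _ _ _ _)/F_faith Eb.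
move=> /(inj_pair2 _ _ _ _ _)/(inj_pair2 _ _ _ _ _) Ec.
subst m' a' b' c'.
by f_equal; apply: proof_irrelevance.
Qed.

Lemma pc_hom1 d : pc_hom (idm (pc_diagram d)).
Proof.
exists (idm _), (idm _); rewrite !fmap1; split=> //.
all: by rewrite comp1m compm1.
Qed.

Lemma pc_homM d d' d'' (psi : hom (pc_diagram d') (pc_diagram d''))
    (phi : hom (pc_diagram d) (pc_diagram d')) :
  pc_hom psi -> pc_hom phi -> pc_hom (psi ∘ phi).
Proof.
case=> [g [f [gf ga fb [g2 g1 g0]]]] [g' [f' [gf' ga' fb' [f2 f1 f0]]]].
exists (g ∘ g'), (f ∘ f'); rewrite !fmapM -?g2 -?g1 -?g0 -?f2 -?f1 -?f0; split=> //.
- by rewrite compA gf -compA gf' compA -g1 -f1.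
- by rewrite compA ga -compA ga' compA.
- by rewrite compA fb -compA fb' compA.
Qed.

Definition PC (F_faith : faithful F) (F_inj : injective_on_objects F) : category :=
  image_subcategory (pc_diagram_inj F_faith F_inj) pc_hom1 pc_homM.
End Adjoint.
End HalfReflection.

(* Main.v *)
(** Transposition along [F ⊣ G] turns [u : A -> GIA] into [c : FA -> IA], and
    [c I(eta_A) = I(u)] because [IG = 1]; hence [I(u) = 1] says exactly that
    [c] is split by [I(eta_A)], and [A_1] corresponds to [RG].  In the same way
    [v : E -> GIE] becomes [m : FE -> IE = FA]: the condition [v b = eta_A]
    becomes [m F(b) = 1], the compatibility of [a] with [u] and [v] becomes
    [c m = c F(a)], and the last condition defining [A_2^*] becomes
    [pi'_A m = pi'_A pi'_E]; finally [I(b) = I(v b) = I(eta_A)] comes for free.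
    Both correspondences are bijective on objects, since transposition is, and
    fully faithful, since [F] is faithful. *)

From Corelib Require Import ssreflect ssrfun ssrbool.
From Stdlib Require Import ProofIrrelevance FunctionalExtensionality.
From Stdlib Require Import IndefiniteDescription.
Require Import Defs.

Set Implicit Arguments.
Unset Strict Implicit.
Unset Printing Implicit Defensive.

Local Open Scope cat_scope.

(** * Isomorphisms of categories from fully faithful functors bijective on objects *)

Definition full (C D : category) (S : functor C D) : Prop :=
  forall (x y : C) (g : hom (S x) (S y)), exists f : hom x y, fmap S f = g.

Section EqhomTheory.
Context (C : category).

Lemma eqhom_symK (x y : C) (e : x = y) : eqhom e ∘ eqhom (eq_sym e) = idm y.
Proof. by case: _ / e; rewrite /= comp1m. Qed.

Lemma eqhomK_sym (x y : C) (e : x = y) : eqhom (eq_sym e) ∘ eqhom e = idm x.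
Proof. by case: _ / e; rewrite /= comp1m. Qed.

Lemma eqhom_irrelevance (x y : C) (e e' : x = y) : eqhom e = eqhom e'.
Proof. by rewrite (proof_irrelevance _ e e'). Qed.
End EqhomTheory.

(** Function extensionality makes the object maps literally equal; proof irrelevance then turns each
    [eqhom] into an identity, so the squares give equality on morphisms. *)
Lemma functor_ext (C D : category) (S T : functor C D)
    (e : forall x, S x = T x) :
  (forall (x y : C) (f : hom x y),
     eqhom (e y) ∘ fmap S f = fmap T f ∘ eqhom (e x)) ->
  S = T.
Proof.
case: S T e => [So Sf S1 SM] [To Tf T1 TM] /= e.
have E : So = To by apply: functional_extensionality.
subst To => H.
have Ef : Sf = Tf.
  apply: functional_extensionality_dep => x.
  apply: functional_extensionality_dep => y.
  apply: functional_extensionality_dep => f.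
  have := H x y f.
  rewrite (proof_irrelevance _ (e x) eq_refl).
  by rewrite (proof_irrelevance _ (e y) eq_refl) /= comp1m compm1.
by subst Tf; f_equal; apply: proof_irrelevance.
Qed.

(** The inverse is [r] on objects; on morphisms it picks a preimage under [S] of the morphism
    transported along [rK]. Fullness supplies the preimage, and faithfulness makes the choice
    functorial. *)
Lemma isomorphic_of_fully_faithful (C D : category) (S : functor C D)
    (r : D -> C) :
  cancel (fob S) r -> cancel r (fob S) -> faithful S -> full S ->
  isomorphic_categories C D.
Proof.
move=> SK rK S_faithful S_full.
have lift (x y : D) (f : hom x y) :
    {h : hom (r x) (r y) | fmap S h = eqhom (eq_sym (rK y)) ∘ f ∘ eqhom (rK x)}.
  exact: constructive_indefinite_description (S_full _ _ _).
have T1 x : proj1_sig (lift x x (idm x)) = idm (r x).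
  by apply: S_faithful; rewrite (proj2_sig (lift _ _ _)) compm1 eqhomK_sym fmap1.
have TM x y z (g : hom y z) (f : hom x y) : proj1_sig (lift x z (g ∘ f)) =
    proj1_sig (lift y z g) ∘ proj1_sig (lift x y f).
  apply: S_faithful; rewrite fmapM !(proj2_sig (lift _ _ _)).
  by rewrite !compA -(compA _ (eqhom (rK y))) eqhom_symK compm1.
pose T := @Functor D C r (fun x y f => proj1_sig (lift x y f)) T1 TM.
exists S, T; split.
- apply: (@functor_ext _ _ (fcomp T S) (fid C) SK) => x y f; apply: S_faithful.
  rewrite !fmapM !fmap_eqhom /= (proj2_sig (lift _ _ _)).
  rewrite (eqhom_irrelevance _ (rK (S y))) (eqhom_irrelevance _ (rK (S x))).
  by rewrite !compA eqhom_symK comp1m.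
- apply: (@functor_ext _ _ (fcomp S T) (fid D) rK) => x y f /=.
  by rewrite (proj2_sig (lift _ _ _)) !compA eqhom_symK comp1m.
Qed.

(** * Isomorphisms onto an image subcategory *)

Section ImageSubcategoryIso.
Context (C : category) (X : Type) (j : X -> C).
Context (R : forall d d' : X, hom (j d) (j d') -> Prop).
Context (j_inj : injective j).
Context (R1 : forall d, R (idm (j d))).
Context (RM : forall d d' d'' (psi : hom (j d') (j d'')) (phi : hom (j d) (j d')),
  R psi -> R phi -> R (psi ∘ phi)).

(** [image_hom] records [R] only at some indices with the right images; injectivity of [j]
    identifies them with [d] and [d']. *)
Lemma image_hom_rel d d' (phi : hom (j d) (j d')) :
  image_hom R phi -> R phi.
Proof.
move=> /(image_hom_inv j_inj (eq_refl : j d' = j d')).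
case=> [d0 [phi' [e [Rphi E]]]].
have Ed := j_inj e; subst d0.
move: E Rphi; rewrite (proof_irrelevance _ e eq_refl) /= compm1 comp1m.
by move=> ->.
Qed.

(** Common frame of both isomorphisms: [k] turns objects of [K] bijectively into data, and [j] sends
    data to diagrams in [B]. *)
Lemma isomorphic_image_subcategory (K : category) (k : K -> X) (k' : X -> K)
    (kmap : forall x y : K, hom x y -> hom (j (k x)) (j (k y))) :
  cancel k k' -> cancel k' k ->
  (forall x, kmap x x (idm x) = idm (j (k x))) ->
  (forall x y z (g : hom y z) (f : hom x y),
     kmap x z (g ∘ f) = kmap y z g ∘ kmap x y f) ->
  (forall x y, injective (kmap x y)) ->
  (forall x y (phi : hom (j (k x)) (j (k y))),
     R phi <-> exists f, kmap x y f = phi) ->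
  isomorphic_categories K (image_subcategory j_inj R1 RM).
Proof.
move=> kK k'K kmap1 kmapM kmap_inj kmapP.
have Rk x y (f : hom x y) : R (kmap x y f) by apply/kmapP; exists f.
pose So (x : K) : image_subcategory j_inj R1 RM :=
  exist _ (j (k x)) (ex_intro _ (k x) eq_refl).
pose Sf x y f : hom (So x) (So y) := exist _ (kmap x y f) (ImageHom (Rk x y f)).
have S1 x : Sf x x (idm x) = idm (So x) by apply/sig_eq/kmap1.
have SM x y z (g : hom y z) (f : hom x y) : Sf x z (g ∘ f) = Sf y z g ∘ Sf x y f.
  by apply/sig_eq/kmapM.
pose preimage (x : image_subcategory j_inj R1 RM) :=
  constructive_indefinite_description _ (proj2_sig x).
apply: (@isomorphic_of_fully_faithful _ _ (Functor S1 SM)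
  (fun x => k' (proj1_sig (preimage x)))).
(* Whichever datum was chosen over [j (k x)], injectivity of [j] makes it [k x]. *)
- move=> x /=; rewrite -[RHS]kK; congr k'; apply: j_inj.
  exact: (proj2_sig (preimage (So x))).
- by move=> x; apply: sig_eq; rewrite /= k'K; apply: (proj2_sig (preimage x)).
- by move=> x y f g /(f_equal (@proj1_sig _ _)) /kmap_inj.
- move=> x y [phi phiP].
  have [f Ef] := (proj1 (kmapP x y phi)) (image_hom_rel phiP).
  by exists f; apply: sig_eq.
Qed.
End ImageSubcategoryIso.

(** * Transposition across an adjunction *)

Section Transposition.
Context (C D : category) (F : functor C D) (G : functor D C).
Context (adj : adjunction F G).

Definition ltrans (x : C) (y : D) (f : hom x (G y)) : hom (F x) y :=
  counit adj y ∘ fmap F f.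

Definition rtrans (x : C) (y : D) (g : hom (F x) y) : hom x (G y) :=
  fmap G g ∘ unit adj x.

Lemma ltransK x y : cancel (@ltrans x y) (@rtrans x y).
Proof.
move=> f; rewrite /rtrans /ltrans fmapM -compA.
rewrite -(ncomp_nat (unit adj) f) compA.
by rewrite [X in X ∘ _]triangle_r comp1m.
Qed.

Lemma rtransK x y : cancel (@rtrans x y) (@ltrans x y).
Proof.
move=> g; rewrite /rtrans /ltrans fmapM compA.
rewrite (ncomp_nat (counit adj) g) -compA.
by rewrite [X in _ ∘ X]triangle_l compm1.
Qed.

Lemma ltrans_inj x y : injective (@ltrans x y).
Proof. exact: can_inj (@ltransK x y). Qed.

Lemma ltrans_compl x x' y (f : hom x' (G y)) (h : hom x x') :
  ltrans (f ∘ h) = ltrans f ∘ fmap F h.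
Proof. by rewrite /ltrans fmapM compA. Qed.

Lemma ltrans_compr x y y' (k : hom y y') (f : hom x (G y)) :
  ltrans (fmap G k ∘ f) = k ∘ ltrans f.
Proof. by rewrite /ltrans fmapM !compA (ncomp_nat (counit adj) k). Qed.

Lemma ltrans_unit x : ltrans (unit adj x : hom x (G (F x))) = idm (F x).
Proof. exact: triangle_l. Qed.
End Transposition.

(** * Transposes in a half-reflection *)

Section HalfReflectionIso.
Context (A B : category) (I : functor A B) (G : functor B A).
Context (pi : nattrans (fid A) (fcomp G I)) (hr : half_reflection pi).
Context (F : functor A B) (adj : adjunction F G).

(** Write [f] as [G] of its transpose after [eta]; then [IG = 1] strips [IG] from [I(f)]. *)
Lemma ltrans_I_eta X Y (f : hom X (G Y)) :
  ltrans adj f ∘ I_eta hr adj X = eqhom (IG hr Y) ∘ fmap I f.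
Proof.
by rewrite -[in RHS](ltransK adj f) /rtrans fmapM compA IG_nat -compA.
Qed.

(** Since [pi'] is the transpose of [pi], this is naturality of [pi], transposed. *)
Lemma pi'_nat X Y (f : hom X Y) :
  pi' pi adj Y ∘ fmap F f = fmap I f ∘ pi' pi adj X.
Proof.
rewrite -[LHS](ltrans_compl adj (pi Y)) -[RHS]ltrans_compr; congr ltrans.
exact: (ncomp_nat pi f).
Qed.

Lemma I_eta_nat X Y (f : hom X Y) :
  fmap F f ∘ I_eta hr adj X = I_eta hr adj Y ∘ fmap I f.
Proof.
rewrite /I_eta compA -IG_nat -!compA -!fmapM; congr (_ ∘ fmap I _).
by rewrite -(ncomp_nat (unit adj) f).
Qed.

(** Each equation is the transpose of the other; the second is the form met in diagrams in [B], for
    [c] and, along [IE = FA], for [m]. *)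
Lemma A1_hom_ltrans (X Y : A1 hr) (f : hom (a1_ob X) (a1_ob Y)) :
  a1_u Y ∘ f = fmap G (fmap I f) ∘ a1_u X <->
  ltrans adj (a1_u Y) ∘ fmap F f = fmap I f ∘ ltrans adj (a1_u X).
Proof.
rewrite -ltrans_compl -ltrans_compr; split=> [-> //|]; exact: ltrans_inj.
Qed.

(** * Reflexive graphs and [A_1] *)

Section ReflexiveGraphs.

Lemma rg_cP_of (X : A1 hr) : ltrans adj (a1_u X) ∘ I_eta hr adj X = idm (I X).
Proof. by rewrite ltrans_I_eta a1_uP. Qed.

Definition rg_of (X : A1 hr) : rg_data hr adj := RGData (rg_cP_of X).

Lemma A1_of_uP (d : rg_data hr adj) :
  eqhom (IG hr (I (rg_A d))) ∘ fmap I (rtrans adj (rg_c d)) = idm (I (rg_A d)).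
Proof. by rewrite -ltrans_I_eta rtransK rg_cP. Qed.

Definition A1_of (d : rg_data hr adj) : A1 hr := A1Ob (A1_of_uP d).

Lemma A1_ob_ext Z (u u' : hom Z (G (I Z))) uP uP' :
  u = u' -> A1Ob (hr := hr) (a1_u := u) uP = A1Ob (a1_u := u') uP'.
Proof. by move=> E; subst u'; rewrite (proof_irrelevance _ uP uP'). Qed.

Lemma rg_ofK : cancel rg_of A1_of.
Proof. by case=> Z u uP; apply: A1_ob_ext; apply: ltransK. Qed.

Lemma A1_ofK : cancel A1_of rg_of.
Proof.
case=> Z c cP; rewrite /rg_of /A1_of /=; move: (rg_cP_of _) => /=.
by rewrite rtransK => cP'; rewrite (proof_irrelevance _ cP cP').
Qed.

Lemma rg_map_axiom (X Y : A1 hr) (f : hom X Y) :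
  @rgraph_hom_axiom B (rg_graph (rg_of X)) (rg_graph (rg_of Y))
    (fmap F (proj1_sig f), fmap I (proj1_sig f)).
Proof.
split=> /=; [exact: pi'_nat | | exact: I_eta_nat].
exact/A1_hom_ltrans/(proj2_sig f).
Qed.

Definition rg_map (X Y : A1 hr) (f : hom X Y) :
    hom (rg_graph (rg_of X)) (rg_graph (rg_of Y)) :=
  exist _ _ (rg_map_axiom f).

Lemma isomorphic_A1_RG (F_faithful : faithful F)
    (F_inj : injective_on_objects F) :
  isomorphic_categories (A1 hr) (RG hr adj F_inj).
Proof.
apply: (isomorphic_image_subcategory (kmap := rg_map) _ _ _ rg_ofK A1_ofK).
- by move=> X; apply: sig_eq; rewrite /= !fmap1.
- by move=> X Y Z g f; apply: sig_eq; rewrite /= !fmapM.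
- move=> X Y f g /(f_equal (fun h => edge_map h)) /F_faithful.
  exact: sig_eq.
- move=> X Y phi; split=> [[f]|[f <-]]; last by exists (proj1_sig f).
  case: phi => [[phi1 phi0] phiP] [E1 E0].
  rewrite /edge_map /vert_map /= in E1 E0; subst phi1 phi0.
  (* The codomain square transposes to the condition defining a morphism of [A_1]. *)
  have [_ /= /A1_hom_ltrans fP _] := phiP.
  by exists (exist _ f fP); apply: sig_eq.
Qed.
End ReflexiveGraphs.

(** * Precategories and [A_2^*] *)

Section Precategories.

(** Here [m] is the transpose of [v] read along [e]. The last two clauses of [A_2^*] transpose to
    the two equations on [m]; proof irrelevance lets any [e] serve as the witness. *)
Lemma A2_star_obP (X : A2 hr)
    (e : I (a1_ob (a2_E X)) = F (a1_ob (a2_A X))) :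
  let m := eqhom e ∘ ltrans adj (a1_u (a2_E X)) in
  A2_star_ob adj X <->
  [/\ fmap I (proj1_sig (a2_a X)) = ltrans adj (a1_u (a2_A X)) ∘ eqhom e,
      m ∘ fmap F (a2_b X) = idm (F (a1_ob (a2_A X))) &
      pi' pi adj (a1_ob (a2_A X)) ∘ m =
      pi' pi adj (a1_ob (a2_A X)) ∘ (eqhom e ∘ pi' pi adj (a1_ob (a2_E X)))].
Proof.
move=> m.
have Eb : eqhom (f_equal (fob G) e) ∘ (a1_u (a2_E X) ∘ a2_b X) =
      unit adj (a1_ob (a2_A X)) <-> m ∘ fmap F (a2_b X) = idm _.
  rewrite -fmap_eqhom -(ltrans_unit adj) /m -ltrans_compr -ltrans_compl -compA.
  by split=> [-> //|]; apply: ltrans_inj.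
have Epi : fmap G (pi' pi adj (a1_ob (a2_A X))) ∘ eqhom (f_equal (fob G) e) ∘
        pi (a1_ob (a2_E X)) =
      fmap G (pi' pi adj (a1_ob (a2_A X))) ∘ eqhom (f_equal (fob G) e) ∘
        a1_u (a2_E X) <->
    pi' pi adj (a1_ob (a2_A X)) ∘ m =
      pi' pi adj (a1_ob (a2_A X)) ∘ (eqhom e ∘ pi' pi adj (a1_ob (a2_E X))).
  rewrite -fmap_eqhom -fmapM /m !(compA _ (eqhom e)).
  rewrite -[pi' pi adj (a1_ob (a2_E X))]/(ltrans adj (pi (a1_ob (a2_E X)))).
  rewrite -!ltrans_compr.
  by split=> [<- //|/ltrans_inj].
split=> [[e' [Ea /= + +]]|[Ea /Eb Eb' /Epi Epi']]; last by exists e.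
by rewrite (proof_irrelevance _ e' e) in Ea * => /Eb Eb' /Epi Epi'.
Qed.

Lemma A2_star_IE (X : A2_star hr adj) :
  I (a1_ob (a2_E (proj1_sig X))) = F (a1_ob (a2_A (proj1_sig X))).
Proof. by case: (proj2_sig X). Qed.

(** This is [I(v) = 1] in transposed form. *)
Lemma A2_star_ml (X : A2_star hr adj) :
  eqhom (A2_star_IE X) ∘ ltrans adj (a1_u (a2_E (proj1_sig X))) ∘
    (I_eta hr adj _ ∘ eqhom (eq_sym (A2_star_IE X))) = idm _.
Proof.
rewrite compA -(compA (eqhom _)) ltrans_I_eta a1_uP compm1.
exact: eqhom_symK.
Qed.

Definition pc_of (X : A2_star hr adj) : pc_data hr adj.
Proof.
refine (@PCData A B I G pi hr F adj (a1_ob (a2_E (proj1_sig X)))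
  (a1_ob (a2_A (proj1_sig X))) (proj1_sig (a2_a (proj1_sig X)))
  (a2_b (proj1_sig X)) (A2_star_IE X)
  (eqhom (A2_star_IE X) ∘ ltrans adj (a1_u (a2_E (proj1_sig X))))
  (ltrans adj (a1_u (a2_A (proj1_sig X))))
  (a2_ab (proj1_sig X)) (rg_cP_of _) _ _ (A2_star_ml X) _ _ _);
  case: (proj1 (A2_star_obP (A2_star_IE X)) (proj2_sig X)) => Ea Eb Epi //.
(* Up to [IE = FA]: [I(b) = m I(eta_E) I(b) = m F(b) I(eta_A) = I(eta_A)]. *)
- rewrite -[LHS]comp1m -A2_star_ml -(compA _ (I_eta hr adj _ ∘ _)).
  rewrite -(compA (I_eta hr adj _)) (compA (eqhom (eq_sym _))) eqhomK_sym comp1m.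
  by rewrite -I_eta_nat compA Eb comp1m.
(* As [c] is [I(a)] along [IE = FA], the equation [c m = c F(a)] is the transposed condition that
   [a] lies in [A_1]. *)
- by rewrite compA -Ea; symmetry; apply/A1_hom_ltrans/(proj2_sig (a2_a _)).
Defined.

(** Inverse to forming [m] from [v]: [m] is read as a map into [IE], then transposed. *)
Definition pc_v (d : pc_data hr adj) : hom (pc_E d) (G (I (pc_E d))) :=
  rtrans adj (eqhom (eq_sym (pc_IE d)) ∘ pc_m d).

Lemma ltrans_pc_v (d : pc_data hr adj) :
  eqhom (pc_IE d) ∘ ltrans adj (pc_v d) = pc_m d.
Proof. by rewrite rtransK compA eqhom_symK comp1m. Qed.

Lemma pc_vP (d : pc_data hr adj) :
  eqhom (IG hr (I (pc_E d))) ∘ fmap I (pc_v d) = idm (I (pc_E d)).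
Proof.
rewrite -ltrans_I_eta rtransK -[LHS]compm1 -(eqhomK_sym (pc_IE d)).
by rewrite compA -(compA _ (I_eta _ _ _)) -(compA _ (pc_m d)) pc_ml compm1.
Qed.

Lemma pc_aP (d : pc_data hr adj) :
  rtrans adj (pc_c d) ∘ pc_a d = fmap G (fmap I (pc_a d)) ∘ pc_v d.
Proof.
apply: (ltrans_inj (adj := adj)).
by rewrite ltrans_compl ltrans_compr rtransK pc_Ia -compA ltrans_pc_v pc_cm.
Qed.

Definition A2_of (d : pc_data hr adj) : A2 hr :=
  @A2Ob _ _ _ _ _ hr (A1Ob (pc_vP d))
    (A1_of (RGData (pc_ce d))) (exist _ (pc_a d) (pc_aP d)) (pc_b d) (pc_ab d).

Lemma A2_star_of_proof (d : pc_data hr adj) : A2_star_ob adj (A2_of d).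
Proof.
apply/(@A2_star_obP (A2_of d) (pc_IE d)) => /=.
by rewrite ltrans_pc_v rtransK; split; [apply: pc_Ia|apply: pc_mr|apply: pc_dm].
Qed.

Definition A2_star_of (d : pc_data hr adj) : A2_star hr adj :=
  exist _ (A2_of d) (A2_star_of_proof d).

(** A round trip keeps [E], [Z], [a] and [b] and changes [v] and [u] only by transposing twice; the
    other fields are proofs. *)
Lemma A2_ob_ext E Z (v v' : hom E (G (I E))) (u u' : hom Z (G (I Z)))
    vP vP' uP uP' (a : hom E Z) (b : hom Z E)
    (aP : u ∘ a = fmap G (fmap I a) ∘ v) (aP' : u' ∘ a = fmap G (fmap I a) ∘ v')
    (ab ab' : a ∘ b = idm Z) :
  v = v' -> u = u' ->
  @A2Ob _ _ _ _ _ hr (A1Ob (a1_u := v) vP) (A1Ob (a1_u := u) uP)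
    (exist _ a aP) b ab =
  @A2Ob _ _ _ _ _ hr (A1Ob (a1_u := v') vP') (A1Ob (a1_u := u') uP')
    (exist _ a aP') b ab'.
Proof.
move=> Ev Eu; subst v' u'.
rewrite (proof_irrelevance _ vP' vP) in aP' ab' *.
rewrite (proof_irrelevance _ uP' uP) in aP' ab' *.
rewrite (proof_irrelevance _ aP' aP) in ab' *.
by rewrite (proof_irrelevance _ ab' ab).
Qed.

Lemma pc_data_ext E Z a b e e' m m' c c' ab ab' ce ce' Ia Ia' Ib Ib' ml ml'
    mr mr' cm cm' dm dm' :
  m = m' -> c = c' ->
  @PCData A B I G pi hr F adj E Z a b e m c ab ce Ia Ib ml mr cm dm =
  @PCData A B I G pi hr F adj E Z a b e' m' c' ab' ce' Ia' Ib' ml' mr' cm' dm'.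
Proof.
move=> Em Ec; subst m' c'; have Ee := proof_irrelevance _ e e'; subst e'.
by f_equal; apply: proof_irrelevance.
Qed.

Lemma pc_ofK : cancel pc_of A2_star_of.
Proof.
case=> [[[E v vP] [Z u uP] [a aP] b ab] X_star]; apply: sig_eq.
apply: A2_ob_ext => /=; last exact: ltransK.
by rewrite /pc_v /= compA eqhomK_sym comp1m ltransK.
Qed.

Lemma A2_star_ofK : cancel A2_star_of pc_of.
Proof.
case=> E Z a b e m c ab ce Ia Ib ml mr cm dm.
apply: pc_data_ext => /=; last exact: rtransK.
(* [pc_of] draws its identity [IE = FA] from the membership proof; it is exchanged here for the
   given [e]. *)
rewrite (eqhom_irrelevance _ e).
exact: (ltrans_pc_v (PCData ab ce Ia Ib ml mr cm dm)).
Qed.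

(* Composing [v' g = GI(g) v] with [b] and using [v b = eta] turns it into
   [GF(f) eta = GI(g) eta], whence [Ff = Ig]. *)
Lemma A2_star_hom_IF (X Y : A2_star hr adj)
    (g : hom (a2_E (proj1_sig X)) (a2_E (proj1_sig Y)))
    (f : hom (a2_A (proj1_sig X)) (a2_A (proj1_sig Y))) :
  a2_b (proj1_sig Y) ∘ proj1_sig f = proj1_sig g ∘ a2_b (proj1_sig X) ->
  eqhom (A2_star_IE Y) ∘ fmap I (proj1_sig g) =
  fmap F (proj1_sig f) ∘ eqhom (A2_star_IE X).
Proof.
move=> fb; set e := A2_star_IE X; set e' := A2_star_IE Y.
have mX : eqhom e ∘ _ ∘ fmap F (a2_b (proj1_sig X)) = idm _ :=
  pc_mr (pc_of X).
have mY : eqhom e' ∘ _ ∘ fmap F (a2_b (proj1_sig Y)) = idm _ :=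
  pc_mr (pc_of Y).
have gP := proj1 (A1_hom_ltrans _) (proj2_sig g).
rewrite -[fmap F (proj1_sig f)]comp1m -mY -(compA _ (fmap F (a2_b _))) -fmapM fb.
rewrite fmapM compA -(compA _ _ (fmap F (proj1_sig g))) gP.
move: (ltrans adj (a1_u (a2_E (proj1_sig X)))) mX => t mX.
rewrite -!compA; congr (_ ∘ _); rewrite -[LHS]compm1; congr (_ ∘ _).
rewrite -[RHS]comp1m -(eqhomK_sym e) -!compA; congr (_ ∘ _).
by rewrite !compA mX comp1m.
Qed.

(** Given [F(f) = I(g)], the squares for [pmul] and [pcod] say that [g] and [f] lie in [A_1], those
    for [psnd] and [pinr] come from compatibility with [a] and [b], and the rest are naturality of
    [pi'] and [I_eta]. *)
Lemma pc_map_axiom (X Y : A2_star hr adj) (gf : hom X Y) :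
  @pdiag_hom_axiom B (pc_diagram (pc_of X)) (pc_diagram (pc_of Y))
    (fmap F (proj1_sig (proj1_sig gf).1), fmap F (proj1_sig (proj1_sig gf).2),
     fmap I (proj1_sig (proj1_sig gf).2)).
Proof.
case: gf => [[g f] [gfa fb]]; have ga := f_equal (@proj1_sig _ _) gfa.
have gf_IF := A2_star_hom_IF fb.
have gP := proj1 (A1_hom_ltrans _) (proj2_sig g).
have fP := proj1 (A1_hom_ltrans _) (proj2_sig f).
rewrite /= in ga fb gf_IF gP fP *.
split=> /=.
- by rewrite -compA pi'_nat compA gf_IF compA.
- by rewrite -compA gP compA gf_IF compA.
- by rewrite -!fmapM ga.
- rewrite compA I_eta_nat -!(compA (I_eta hr adj _)); congr (_ ∘ _).
  rewrite -[LHS]comp1m -(eqhomK_sym (A2_star_IE Y)) -!compA; congr (_ ∘ _).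
  by rewrite (compA (eqhom _)) gf_IF -compA eqhom_symK compm1.
- by rewrite -!fmapM fb.
- exact: pi'_nat.
- exact: fP.
- exact: I_eta_nat.
Qed.

Definition pc_map (X Y : A2_star hr adj) (gf : hom X Y) :
    hom (pc_diagram (pc_of X)) (pc_diagram (pc_of Y)) :=
  exist _ _ (pc_map_axiom gf).

Lemma isomorphic_A2_star_PC (F_faithful : faithful F)
    (F_inj : injective_on_objects F) :
  isomorphic_categories (A2_star hr adj) (PC hr adj F_faithful F_inj).
Proof.
apply: (isomorphic_image_subcategory (kmap := pc_map) _ _ _ pc_ofK A2_star_ofK).
- by move=> X; apply: sig_eq; rewrite /= !fmap1.
- by move=> X Y Z g f; apply: sig_eq; rewrite /= !fmapM.
- move=> X Y [[g f] gfP] [[g' f'] gfP'] E; apply: sig_eq => /=; congr pair.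
    exact/sig_eq/F_faithful/(f_equal (fun h => map2 h) E).
  exact/sig_eq/F_faithful/(f_equal (fun h => map1 h) E).
- move=> X Y phi; split=> [[g [f]]|[[[g f] gfP] <-]].
    case: phi => [[[phi2 phi1] phi0] phiP] [gf_IF ga fb [E2 E1 E0]].
    rewrite /map2 /map1 /map0 /= in gf_IF ga fb E2 E1 E0.
    subst phi2 phi1 phi0.
    have fP := proj2 (A1_hom_ltrans _) (phom_cod phiP).
    (* The [pmul] square with [F(f)] replaced by [I(g)]: cancelling the identity [IE' = FA'] leaves
       the transposed condition on [g]. *)
    have gP : a1_u (a2_E (proj1_sig Y)) ∘ g =
        fmap G (fmap I g) ∘ a1_u (a2_E (proj1_sig X)).
      apply/A1_hom_ltrans; have := phom_mul phiP; rewrite /= compA -gf_IF.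
      move=> /(f_equal (comp (eqhom (eq_sym (A2_star_IE Y))))).
      by rewrite !compA eqhomK_sym !comp1m.
    have gfP : @A2_hom_axiom _ _ _ _ _ _ (proj1_sig X) (proj1_sig Y)
        (exist _ g gP, exist _ f fP).
      by split=> //; apply: sig_eq.
    by exists (exist _ _ gfP); apply: sig_eq.
  exists (proj1_sig g), (proj1_sig f).
  case: (gfP) => [gfa fb]; have ga := f_equal (@proj1_sig _ _) gfa.
  (* The equation [I(g) = F(f)] required in [PC] is derived from compatibility with the sections
     [b]. *)
  by split=> //; apply: A2_star_hom_IF.
Qed.
End Precategories.

End HalfReflectionIso.

Theorem theorem15 (A B : category) (I : functor A B) (G : functor B A)
    (pi : nattrans (fid A) (fcomp G I)) (hr : half_reflection pi)
    (F : functor A B) (adj : adjunction F G)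
    (F_faithful : faithful F) (F_inj : injective_on_objects F) :
  isomorphic_categories (A1 hr) (RG hr adj F_inj) /\
  isomorphic_categories (A2_star hr adj) (PC hr adj F_faithful F_inj).
Proof. by split; [apply: isomorphic_A1_RG|apply: isomorphic_A2_star_PC]. Qed.
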